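(* Let $N\ge1$ be an integer and let $F_N:[0,1]\to[0,1]$ be given by $$F_N(x)=\begin{cases}\frac{N}{x}-N& \text{for }x\in\left(\frac{N}{N+1},1\right],\\ \frac{Nx}{N-x}&\text{for }x\in\left[0,\frac{N}{N+1}\right].\end{cases}$$ The infinite measure $\frac{dx}{x}$ is an invariant measure for the dynamical system $(F_N,[0,1],\mathcal{B})$.
   Context: $\mathcal{B}$ is the Borel $\sigma$-algebra on $[0,1]$; $\frac{dx}{x}$ is the measure $\mu(A)=\int_A\frac1x\,dx$ on $[0,1]$. Invariance means $\mu(F_N^{-1}(A))=\mu(A)$ for all $A\in\mathcal{B}$. *)

(* Defs.v *)
From HB Require Import structures.
From mathcomp Require Import all_boot all_order all_algebra.
From mathcomp Require Import all_classical all_reals all_analysis.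
From mathcomp Require Import measurable_realfun.
Set Implicit Arguments.
Unset Strict Implicit.
Unset Printing Implicit Defensive.
Import Order.TTheory GRing.Theory Num.Theory.
Import numFieldNormedType.Exports.

Local Open Scope classical_set_scope.
Local Open Scope ring_scope.

(* Only the values on [0, 1] matter; the map is total on R for convenience. *)
Definition F {R : realType} (N : nat) (x : R) : R :=
  if N%:R / N.+1%:R < x then N%:R / x - N%:R else N%:R * x / (N%:R - x).

(* The measure dx/x on [0, 1], as a Borel measure on R carried by [0, 1].
   The integrand takes the value 0^-1 = 0 at the Lebesgue-null point 0. *)
Definition dx_over_x {R : realType} (A : set (measurableTypeR R)) : \bar R :=
  (\int[lebesgue_measure]_(x in A `&` `[0%R, 1%R]) (x^-1)%:E)%E.

Section dx_over_x_measure.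
Variable R : realType.
Local Notation mu := (@dx_over_x R).

Let measurable_inv : measurable_fun [set: R] (@GRing.inv R).
Proof.
have -> : [set: R] = [set 0] `|` ~` [set 0] by rewrite setUv.
apply/measurable_funU => //; first exact: measurableC.
split; first exact: measurable_fun_set1.
apply: open_continuous_measurable_fun.
  by apply: closed_openC; exact: closed_eq.
by move=> x; rewrite inE/= => /eqP x0; exact: inv_continuous.
Qed.

Let dx_over_x0 : mu set0 = 0%E.
Proof. by rewrite /dx_over_x set0I integral_set0. Qed.

Let inv_ge0 (A : set R) x : (A `&` `[0%R, 1%R]) x -> (0 <= (x^-1)%:E)%E.
Proof. by move=> [_ /=]; rewrite in_itv/= lee_fin invr_ge0 => /andP[]. Qed.

Let dx_over_x_ge0 A : (0 <= mu A)%E.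
Proof. by apply: integral_ge0 => x; exact: inv_ge0. Qed.

Let dx_over_x_sigma_additive : semi_sigma_additive mu.
Proof.
move=> A mA tA mUA; rewrite /dx_over_x setI_bigcupl ge0_integral_bigcup//=.
- apply: is_cvg_ereal_nneg_natsum_cond => n _ _.
  by apply: integral_ge0 => x; exact: inv_ge0.
- by move=> k; apply: measurableI => //; exact: measurable_itv.
- by apply/measurable_EFinP/measurable_funTS; exact: measurable_inv.
- by move=> x [k _]; exact: inv_ge0.
- by apply: trivIset_setIr.
Qed.

HB.instance Definition _ := isMeasure.Build _ _ _ mu
  dx_over_x0 dx_over_x_ge0 dx_over_x_sigma_additive.

End dx_over_x_measure.

(* f restricts to a measurable self-map of X, where X carries the trace
   sigma-algebra, and this self-map preserves mu; X `&` f @^-1` A is the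
   preimage of A under the restriction of f to X. *)
Definition invariant_measure_on d (T : measurableType d) (R : realType)
    (X : set T) (f : T -> T) (mu : {measure set T -> \bar R}) : Prop :=
  [/\ set_fun X X f, measurable_fun X f &
      forall A : set T, measurable A -> A `<=` X ->
        mu (X `&` f @^-1` A) = mu A].

(* Main.v *)
(** For [0 < a < 1] the two branches of [F N] send to [(a, 1]] the adjacent
    pieces [(N a / (N + a), N / (N + 1)]] and [(N / (N + 1), N / (N + a))],
    whose union is a single interval with endpoint ratio [a]; its [dx/x]-measure is
    therefore [- ln a], the measure of [(a, 1]].  Both measures are finite on
    the rays [(a, +oo)] with [0 < a], so they agree on Borel subsets of
    [(0, +oo)], and both vanish at [0]. *)
Require Import Defs.
From mathcomp Require Import all_boot all_order all_algebra.
From mathcomp Require Import all_classical all_reals all_analysis.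
From mathcomp Require Import measurable_realfun ring lra.
Import Order.TTheory GRing.Theory Num.Theory.
Import numFieldNormedType.Exports.
Local Open Scope classical_set_scope.
Local Open Scope ring_scope.

Lemma measurable_fun_invr (R : realType) (D : set R) :
  measurable_fun D (@GRing.inv R).
Proof.
apply: measurable_funTS.
(* The point [0], where inversion is discontinuous, is split off; on its open complement continuity
   gives measurability. *)
have -> : [set: R] = [set 0] `|` ~` [set 0] by rewrite setUv.
apply/measurable_funU => //; first exact: measurableC.
split; first exact: measurable_fun_set1.
apply: open_continuous_measurable_fun.
  by apply: closed_openC; exact: closed_eq.
by move=> x; rewrite inE/= => /eqP x0; exact: inv_continuous.
Qed.

Lemma measurable_fun_F (R : realType) (N : nat) :
  measurable_fun [set: R] (@F R N).
Proof.
apply: measurable_fun_ifT.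
- exact: measurable_fun_ltr.
- apply: measurable_funB => //; apply: measurable_funM => //.
  exact: measurable_fun_invr.
- apply: measurable_funM; first exact: measurable_funM.
  apply: (measurableT_comp (@measurable_fun_invr R setT)).
  exact: measurable_funB.
Qed.

(** Fundamental theorem of calculus with primitive [ln]; endpoints are Lebesgue-null, so one formula
    serves all four kinds of interval. *)
Lemma integral_inv_itv (R : realType) (a b : R) (ba bb : bool) :
  0 < a -> a <= b ->
  (\int[lebesgue_measure]_(x in [set` Interval (BSide ba a) (BSide bb b)])
     (x^-1)%:E = (ln b - ln a)%:E)%E.
Proof.
move=> a0; rewrite le_eqVlt => /predU1P[<-|ab].
  rewrite subrr; apply: (@integral_Sset1 _ _ _ a) => x /=.
  by rewrite in_itv/= => /andP[]; case: ba; case: bb => /=; lra.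
have minv : measurable_fun `]a, b[ (fun x : R => (x^-1)%:E).
  by apply/measurable_EFinP; exact: measurable_fun_invr.
(* Pass to the open interval, then back to the closed one, on which [continuous_FTC2] is stated. *)
rewrite integral_itv_bndoo// -(integral_itv_bndoo true false minv).
have cln c : 0 < c -> {for c, continuous (@ln R)} by exact: continuous_ln.
rewrite (@continuous_FTC2 _ _ (@ln R))//.
- apply: continuous_in_subspaceT => x; rewrite inE/= in_itv/= => /andP[ax _].
  by apply: inv_continuous; rewrite gt_eqF// (lt_le_trans a0).
- split.
  + move=> x; rewrite in_itv/= => /andP[ax _].
    by have [] := is_derive1_ln (lt_trans a0 ax).
  + exact/cvg_at_right_filter/cln.
  + exact/cvg_at_left_filter/cln/(lt_trans a0).
- move=> x; rewrite in_itv/= => /andP[ax _]; rewrite derive1E.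
  by have /@derive_val := is_derive1_ln (lt_trans a0 ax).
Qed.

Lemma dx_over_x_itv (R : realType) (a b : R) (ba bb : bool) :
  0 < a -> a <= b -> b <= 1 ->
  dx_over_x [set` Interval (BSide ba a) (BSide bb b)] = (ln b - ln a)%:E.
Proof.
move=> a0 ab b1; rewrite /dx_over_x setIidl ?integral_inv_itv// => x /=.
by rewrite !in_itv/= => /andP[]; case: ba; case: bb => /=; lra.
Qed.

Lemma dx_over_x_setI01 (R : realType) (A : set R) :
  dx_over_x (A `&` `[0, 1]) = dx_over_x A.
Proof. by rewrite /dx_over_x -setIA setIid. Qed.

Lemma dx_over_x_set1 (R : realType) (r : R) : dx_over_x [set r] = 0%E.
Proof. by rewrite /dx_over_x; apply: (@integral_Sset1 _ _ _ r) => x []. Qed.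

Lemma dx_over_x01 (R : realType) : dx_over_x (`[0, 1] : set R) = +oo%E.
Proof.
(* This [e] gives [[e, 1]] the measure [- ln e = Num.max r 0], at least [r]; the maximum with [0]
   ensures [e <= 1]. *)
apply: eq_infty => r; pose e : R := expR (- Num.max r 0).
have e0 : 0 < e by exact: expR_gt0.
have e1 : e <= 1 by rewrite -expR0 ler_expR oppr_le0 le_max lexx orbT.
apply: (@le_trans _ _ (dx_over_x (`[e, 1] : set R))).
  by rewrite dx_over_x_itv// ln1 expRK sub0r opprK lee_fin le_max lexx.
apply: (@le_measure _ _ _ (@dx_over_x R)); rewrite ?inE//.
by move=> x /=; rewrite !in_itv/= => /andP[ex ->]; rewrite (le_trans (ltW e0)).
Qed.

Lemma dx_over_x_gt (R : realType) (a : R) : 0 < a ->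
  dx_over_x (`]a, +oo[ : set R) = (- ln (Num.min a 1))%:E.
Proof.
move=> a0; rewrite -dx_over_x_setI01.
(* For [1 <= a] the right-hand side is the empty interval from [1] to [1], matching [ln 1 = 0]. *)
have -> : `]a, +oo[ `&` `[0, 1] = `]Num.min a 1, 1]%classic :> set R.
  by apply/seteqP; split=> x /=; rewrite !in_itv/= andbT minEle;
    case: ifPn => a1; first [move=> [? /andP[]]|move=> /andP[]]; lra.
by rewrite dx_over_x_itv ?lt_min ?a0 ?ge_min ?lexx ?orbT//= ln1 sub0r.
Qed.

Lemma F_itv01 (R : realType) (N : nat) : (1 <= N)%N ->
  set_fun `[0, 1] `[0, 1] (@F R N).
Proof.
rewrite -(ler1n R) => N1 x /=; rewrite !in_itv/= /F -natr1 => /andP[x0 x1].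
have N10 : 0 < N%:R + 1 :> R by lra.
rewrite ltr_pdivrMr//; case: (ltP N%:R (x * _)) => [Nx|xN].
- have {}x0 : 0 < x by nra.
  by rewrite subr_ge0 lerBlDr ler_pdivlMr// ler_pdivrMr//; nra.
- have Nx0 : 0 < N%:R - x by nra.
  by rewrite ler_pdivlMr// ler_pdivrMr//; nra.
Qed.

(* For [1 <= a] both sides are empty. *)
Lemma F_preimage_gt (R : realType) (N : nat) (a : R) : (1 <= N)%N -> 0 < a ->
  `[0, 1] `&` F N @^-1` `]a, +oo[ =
  `]N%:R * a / (N%:R + a), N%:R / (N%:R + a)[%classic :> set R.
Proof.
rewrite -(ler1n R) => N1 a0; have Na0 : 0 < N%:R + a by lra.
have N10 : 0 < N%:R + 1 :> R by lra.
apply/seteqP; split=> x /=; rewrite !in_itv/= andbT /F -natr1.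
- move=> [/andP[x0 x1]].
  rewrite !(ltr_pdivrMr _ _ Na0, ltr_pdivlMr _ _ Na0, ltr_pdivrMr _ _ N10).
  case: (ltP N%:R (x * _)) => [Nx|xN].
  + have {}x0 : 0 < x by rewrite -(pmulr_lgt0 _ N10); lra.
    rewrite ltrBrDr ltr_pdivlMr// => ax.
    have a1 : a < 1 by rewrite -(ltr_pM2r x0); lra.
    (* Added to [a] times the inequality [Nx], this product yields the lower bound
       [N a < x (N + a)]. *)
    have xNa : 0 <= (1 - a) * (x * N%:R) by rewrite !mulr_ge0//; lra.
    by apply/andP; split; nra.
  + have Nx0 : 0 < N%:R - x by nra.
    rewrite ltr_pdivlMr// => ax.
    have a1 : a < 1 by rewrite ltNge; apply/negP => a1; nra.
    have {}x0 : 0 < x by nra.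
    by apply/andP; split; nra.
- rewrite !(ltr_pdivrMr _ _ Na0, ltr_pdivlMr _ _ Na0, ltr_pdivrMr _ _ N10).
  move=> /andP[ax xa].
  have x0 : 0 < x by nra.
  have x1 : x < 1 by nra.
  split; first by rewrite !ltW.
  case: (ltP N%:R (x * _)) => [Nx|xN].
  + by rewrite ltrBrDr ltr_pdivlMr//; nra.
  + have Nx0 : 0 < N%:R - x by nra.
    by rewrite ltr_pdivlMr//; nra.
Qed.

Lemma dx_over_x_F_preimage_gt (R : realType) (N : nat) (a : R) :
  (1 <= N)%N -> 0 < a ->
  dx_over_x (F N @^-1` `]a, +oo[ : set R) = dx_over_x (`]a, +oo[ : set R).
Proof.
move=> N1 a0; have N0 : 0 < N%:R :> R by rewrite ltr0n.
have Na0 : 0 < N%:R + a by rewrite addr_gt0.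
rewrite -dx_over_x_setI01 setIC F_preimage_gt// dx_over_x_gt// minEle.
case: leP => [a1|a1].
- rewrite dx_over_x_itv.
  + rewrite !(ln_div, lnM) ?posrE ?mulr_gt0//; congr EFin; ring.
  + by rewrite divr_gt0// mulr_gt0.
  + by rewrite ler_pM2r ?invr_gt0// ler_piMr// ltW.
  + by rewrite ler_pdivrMr// mul1r lerDl ltW.
- rewrite ln1 oppr0 (_ : [set` _] = set0) ?(@measure0 _ _ _ (@dx_over_x R))//.
  apply/seteqP; split=> x //=; rewrite in_itv/= => /andP[/lt_trans/[apply]].
  by rewrite ltr_pM2r ?invr_gt0// gtr_pMr//; lra.
Qed.

(** The measures may be infinite near [0], so uniqueness on the pi-system of rays is applied to
    their restrictions to [D n], where [m1] is finite. Continuity from below then passes to the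
    union of the [D n], which is [(0, +oo)]. *)
Lemma measure_eq_pos (R : realType)
    (m1 m2 : {measure set (measurableTypeR R) -> \bar R}) :
  (forall a : R, 0 < a -> (m1 `]a, +oo[%classic < +oo)%E) ->
  (forall a : R, 0 < a -> m1 `]a, +oo[%classic = m2 `]a, +oo[%classic) ->
  forall A : set (measurableTypeR R), measurable A ->
    A `<=` `]0, +oo[%classic -> m1 A = m2 A.
Proof.
move=> fin1 m12 A mA A0.
pose D n : set R := `]n.+1%:R^-1, +oo[%classic.
have mD n : measurable (D n : set (measurableTypeR R)) by exact: measurable_itv.
have D_eq n : m1 (A `&` D n) = m2 (A `&` D n).
  have gt_setI (a b : R) :
      `]a, +oo[ `&` `]b, +oo[ = `]Num.max a b, +oo[%classic :> set R.
    by apply/seteqP; split=> x /=; rewrite !in_itv/= !andbT gt_max => /andP.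
  (* Any ray, even one starting at a negative point, meets [D n] in a ray with positive endpoint, to
     which the hypotheses apply. *)
  have maxD (a : R) : 0 < Num.max a n.+1%:R^-1.
    by rewrite lt_max invr_gt0 ltr0n orbT.
  rewrite -[LHS]/(mrestr m1 (mD n) A) -[RHS]/(mrestr m2 (mD n) A).
  apply: (measure_unique (T := measurableTypeR R) (@RGenOInfty.G R)
    (fun k => `]- k%:R, +oo[%classic)) => //.
  - exact: RGenOInfty.measurableE.
  - by move=> _ _ [a ->] [b ->]; exists (Num.max a b); exact: gt_setI.
  - by move=> k; exists (- k%:R).
  - apply/seteqP; split=> // x _; exists (Num.truncn `|x|).+1 => //=.
    rewrite in_itv/= andbT ltrNl (le_lt_trans _ (truncnS_gt _))//.
    by rewrite -normrN ler_norm.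
  - by move=> _ [a ->]; rewrite /= /mrestr gt_setI; exact/m12/maxD.
  - by move=> k; rewrite /= /mrestr gt_setI; exact/fin1/maxD.
have AE : A = \bigcup_n (A `&` D n).
  rewrite -setI_bigcupr; apply/esym/setIidl => x /A0/=; rewrite in_itv/= andbT.
  move=> /ltr_add_invr[k]; rewrite add0r => kx; exists k => //.
  by rewrite /D/= in_itv/= andbT.
have cvgD (m : {measure set (measurableTypeR R) -> \bar R}) :
    m (A `&` D n) @[n --> \oo] --> m A.
  rewrite [in X in _ --> X]AE; apply: nondecreasing_cvg_mu.
  - by move=> n; exact: measurableI.
  - by rewrite -AE.
  - move=> i j ij; apply/subsetPset; apply: setIS => x.
    rewrite /D/= !in_itv/= !andbT.
    by apply: le_lt_trans; rewrite lef_pV2 ?posrE// ler_nat ltnS.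
apply: (cvg_unique (@ereal_hausdorff R) (cvgD m1)).
by rewrite (funext D_eq); exact: cvgD.
Qed.

(** In [[0, 1]] the first branch can vanish only at [1] and the second only at [0], so the preimage
    lies in a null set of two points. *)
Lemma dx_over_x_F_preimage0 (R : realType) (N : nat) : (1 <= N)%N ->
  dx_over_x (F N @^-1` [set 0] : set R) = 0%E.
Proof.
rewrite -(ler1n R) => N1; rewrite -dx_over_x_setI01.
have null01 : @dx_over_x R ([set 0] `|` [set 1]) = 0%E.
  by apply: (@null_set_setU _ _ _ (@dx_over_x R)) => //; exact: dx_over_x_set1.
apply: (@subset_measure0 _ _ _ (@dx_over_x R) _ ([set 0] `|` [set 1])) => //.
  apply: measurableI => //; rewrite -[X in measurable X]setTI.
  exact: measurable_fun_F.
  exact: measurableU.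
move=> x [/= + /itvP x01]; have x0 : 0 <= x by rewrite x01.
have x1 : x <= 1 by rewrite x01.
rewrite /F -natr1.
have N10 : 0 < N%:R + 1 :> R by lra.
rewrite ltr_pdivrMr//; case: (ltP N%:R (x * _)) => [Nx|xN].
- have {}x0 : 0 < x by nra.
  move=> /subr0_eq Nx1; right; apply/eqP; rewrite eq_le x1/=.
  have : N%:R / x * x = N%:R by rewrite divfK// gt_eqF.
  by rewrite Nx1; nra.
- have Nx0 : 0 < N%:R - x by nra.
  (* Since [0^-1 = 0], the case [N - x = 0] also appears here; it contradicts [Nx0]. *)
  by move/eqP; rewrite !mulf_eq0 invr_eq0 => /orP[/orP[]|] /eqP ?; left; lra.
Qed.

Theorem proposition6p2 (R : realType) (N : nat) (hN : (1 <= N)%N) :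
  dx_over_x (`[0, 1] : set R) = +oo%E /\
  invariant_measure_on (`[0, 1] : set (measurableTypeR R)) (F N)
    (dx_over_x : {measure set (measurableTypeR R) -> \bar R}).
Proof.
split; first exact: dx_over_x01.
have mF := @measurable_fun_F R N.
split; [exact: F_itv01|exact: measurable_funTS|].
move=> A mA A01.
(* The measure is carried by [[0, 1]], so the claim becomes an equality between a pushforward under
   [F N] and [dx_over_x] itself. *)
rewrite setIC [LHS]dx_over_x_setI01.
pose m1 : {measure set (measurableTypeR R) -> \bar R} := @dx_over_x R.
unshelve epose (m2 :=
  pushforward m1 (F N : measurableTypeR R -> measurableTypeR R)
  : {measure set (measurableTypeR R) -> \bar R}); first exact: mF.
rewrite -[LHS]/(m2 A) -[RHS]/(m1 A).
have mpos : measurable (`]0, +oo[ : set (measurableTypeR R)).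
  by exact: measurable_itv.
have AE : A = (A `&` `]0, +oo[) `|` (A `&` [set 0]).
  rewrite -setIUr; apply/esym/setIidl => x /A01/=.
  by rewrite !in_itv/= andbT le_eqVlt => /andP[/predU1P[<-|]]; [right|left].
(* A measure that is null at [0] is determined on [A] by the positive part of [A]. *)
have m0 (m : {measure set (measurableTypeR R) -> \bar R}) :
    m [set 0] = 0%E -> m A = m (A `&` `]0, +oo[).
  move=> m0; rewrite {1}AE measureU0//; try exact: measurableI.
  by apply: (subset_measure0 _ _ _ m0) => //; exact: measurableI.
rewrite !m0; last 2 first.
- exact: dx_over_x_set1.
- exact: dx_over_x_F_preimage0.
(* Symmetry puts [m1] first, so that finiteness on rays is read off from the explicit logarithm. *)
apply/esym/measure_eq_pos; last 2 first.
- exact: measurableI.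
- by move=> x [].
- by move=> a a0; rewrite /m1 /= dx_over_x_gt// ltry.
- by move=> a a0; apply/esym/dx_over_x_F_preimage_gt.
Qed.
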